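(* Let $\mathbf{A}$ be a real $m\times n$ matrix with columns $A_1,\ldots,A_n$ and $k\equiv\mathrm{rank}(\mathbf{A})$, and let $\mathbf{A}=\mathbf{U}\mathbf{\Sigma}\mathbf{V}^T$ be a thin SVD. Let $t_1,\ldots,t_k\in\{1,\ldots,n\}$ and $w_1,\ldots,w_k\geq 0$. Then $\sum_{j=1}^k w_j\,A_{t_j}A_{t_j}^T=\mathbf{A}\mathbf{A}^T$ if and only if the matrix $$\mathbf{V}^T\begin{pmatrix}\sqrt{w_1}\,e_{t_1} & \cdots & \sqrt{w_k}\,e_{t_k}\end{pmatrix}$$ has orthonormal rows. Moreover, if this matrix has orthonormal rows, then it is an orthogonal matrix, and $w_j=1/\|\mathbf{V}^Te_{t_j}\|_2^2$ for $1\leq j\leq k$.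
   Context: The thin SVD of a real $m\times n$ matrix $\mathbf{A}$ of rank $k$ is $\mathbf{A}=\mathbf{U}\mathbf{\Sigma}\mathbf{V}^T$, where $\mathbf{U}$ ($m\times k$) and $\mathbf{V}$ ($n\times k$) have orthonormal columns, and $\mathbf{\Sigma}$ is the $k\times k$ diagonal matrix of the non-zero singular values $\sigma_1\geq\cdots\geq\sigma_k>0$. The vectors $e_1,\ldots,e_n$ are the columns of $\mathbf{I}_n$; $\|\cdot\|_2$ is the Euclidean norm. *)

(* Defs.v *)
From HB Require Import structures.
From mathcomp Require Import all_boot all_order all_algebra.
Set Implicit Arguments. Unset Strict Implicit. Unset Printing Implicit Defensive.
Import Order.TTheory GRing.Theory Num.Theory.
Local Open Scope ring_scope.

(* The scalars are an arbitrary real closed field [R : rcfType]; the field of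
   real numbers is an instance. *)

Definition norm2 (R : rcfType) (n : nat) (v : 'cV[R]_n) : R :=
  Num.sqrt (\sum_i v i 0 ^+ 2).

Definition orthonormal_rows (R : rcfType) (p q : nat) (M : 'M[R]_(p, q)) : Prop :=
  forall i j : 'I_p, \sum_l M i l * M j l = (i == j)%:R.

Definition orthonormal_cols (R : rcfType) (p q : nat) (M : 'M[R]_(p, q)) : Prop :=
  forall i j : 'I_q, \sum_l M l i * M l j = (i == j)%:R.

Definition orthogonal_matrix (R : rcfType) (p : nat) (Q : 'M[R]_p) : Prop :=
  Q^T *m Q = 1%:M /\ Q *m Q^T = 1%:M.

(* The singular values are given by the row [s]; the matrix Sigma is
   [diag_mx s]. *)
Definition thin_svd (R : rcfType) (m n k : nat) (A : 'M[R]_(m, n))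
    (U : 'M[R]_(m, k)) (s : 'rV[R]_k) (V : 'M[R]_(n, k)) : Prop :=
  [/\ k = \rank A,
      orthonormal_cols U,
      orthonormal_cols V,
      (forall i : 'I_k, 0 < s 0 i) /\
      (forall i j : 'I_k, (i <= j)%N -> s 0 j <= s 0 i)
    & A = U *m diag_mx s *m V^T].

Definition std_basis (R : rcfType) (n : nat) (i : 'I_n) : 'cV[R]_n :=
  col i (1%:M).

Definition sampling_matrix (R : rcfType) (n c : nat)
    (t : 'I_c -> 'I_n) (w : 'I_c -> R) : 'M[R]_(n, c) :=
  \matrix_(i < n, j < c) (Num.sqrt (w j) *: std_basis R (t j)) i 0.

(* Main.v *)
Require Import Defs.
From HB Require Import structures.
From mathcomp Require Import all_boot all_order all_algebra.
Set Implicit Arguments. Unset Strict Implicit. Unset Printing Implicit Defensive.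
Import Order.TTheory GRing.Theory Num.Theory.
Local Open Scope ring_scope.

(** Let [S] be the sampling matrix and [M = V^T S].  Column [j] of [A S] is
    [sqrt (w j)] times column [t j] of [A], so expanding [(A S) (A S)^T] into
    outer products of columns shows that the weighted sum is [A S S^T A^T]
    ([sampled_outer_products]).  Substituting [A = U Sigma V^T], and using
    [V^T V = 1] on the other side, the equation with [A A^T] reads
      [(U Sigma) (M M^T) (U Sigma)^T = (U Sigma) 1 (U Sigma)^T].
    The factor [U Sigma] has a left inverse, since [U] has orthonormal columns
    and the singular values are nonzero; hence it cancels on both sides
    ([congr_mx_inj]) and the equation amounts to [M M^T = 1].

    As [M] is square, [M M^T = 1] forces [M^T M = 1].  Column [j] of [M] is
    [sqrt (w j)] times [V^T e_(t j)], so the [j]-th diagonal entry of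
    [M^T M = 1] is [w j * norm2 (V^T e_(t j)) ^ 2 = 1], which gives both the
    nonvanishing of the norm and the value of the weight. *)

Lemma orthonormal_rowsP (R : rcfType) (p q : nat) (M : 'M[R]_(p, q)) :
  orthonormal_rows M <-> M *m M^T = 1%:M.
Proof.
have gramE i j : (M *m M^T) i j = \sum_l M i l * M j l.
  by rewrite mxE; apply: eq_bigr => l _; rewrite mxE.
split=> [oM | MMt i j]; first by apply/matrixP => i j; rewrite gramE oM mxE.
by rewrite -gramE MMt mxE.
Qed.

Lemma orthonormal_colsP (R : rcfType) (p q : nat) (M : 'M[R]_(p, q)) :
  orthonormal_cols M <-> M^T *m M = 1%:M.
Proof.
have gramE i j : (M^T *m M) i j = \sum_l M l i * M l j.
  by rewrite mxE; apply: eq_bigr => l _; rewrite mxE.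
split=> [oM | MtM i j]; first by apply/matrixP => i j; rewrite gramE oM mxE.
by rewrite -gramE MtM mxE.
Qed.

Lemma mulmx_tr_sum_col (R : comPzRingType) (p q : nat) (M : 'M[R]_(p, q)) :
  M *m M^T = \sum_j col j M *m (col j M)^T.
Proof.
apply/matrixP => i i'; rewrite mxE summxE; apply: eq_bigr => j _.
by rewrite !mxE big_ord1 !mxE.
Qed.

Lemma sqr_norm2 (R : rcfType) (n : nat) (v : 'cV[R]_n) :
  norm2 v ^+ 2 = \sum_i v i 0 ^+ 2.
Proof. by rewrite sqr_sqrtr // sumr_ge0 // => i _; rewrite sqr_ge0. Qed.

Lemma col_mul_sampling (R : rcfType) (m n c : nat) (B : 'M[R]_(m, n))
    (t : 'I_c -> 'I_n) (w : 'I_c -> R) (j : 'I_c) :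
  col j (B *m sampling_matrix t w)
    = Num.sqrt (w j) *: (B *m std_basis R (t j)).
Proof.
rewrite colE -mulmxA -colE scalemxAr; congr (_ *m _).
by apply/colP => i; rewrite !mxE.
Qed.

Lemma mulmx_std_basis (R : rcfType) (m n : nat) (B : 'M[R]_(m, n)) (i : 'I_n) :
  B *m std_basis R i = col i B.
Proof. by rewrite /std_basis !colE mul1mx. Qed.

Lemma sampled_outer_products (R : rcfType) (m n c : nat) (A : 'M[R]_(m, n))
    (t : 'I_c -> 'I_n) (w : 'I_c -> R) :
    (forall j, 0 <= w j) ->
  \sum_(j < c) w j *: (col (t j) A *m (col (t j) A)^T)
    = (A *m sampling_matrix t w) *m (A *m sampling_matrix t w)^T.
Proof.
move=> w_ge0; rewrite mulmx_tr_sum_col; apply: eq_bigr => j _.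
rewrite col_mul_sampling mulmx_std_basis linearZ /=.
by rewrite -scalemxAl -scalemxAr scalerA -expr2 sqr_sqrtr.
Qed.

(** A left inverse of [B] transposes to a right inverse of [B^T], so both
    outer factors can be stripped from [B *m X *m B^T]. *)
Lemma congr_mx_inj (R : comPzRingType) (m k : nat)
    (B : 'M[R]_(m, k)) (C : 'M[R]_(k, m)) :
  C *m B = 1%:M -> injective (fun X : 'M[R]_k => B *m X *m B^T).
Proof.
move=> CB X Y eqXY.
have strip Z : C *m (B *m Z *m B^T) *m C^T = Z.
  by rewrite !mulmxA CB mul1mx -mulmxA -trmx_mul CB trmx1 mulmx1.
by rewrite -[X]strip eqXY strip.
Qed.

Lemma svd_left_inverse (R : rcfType) (m k : nat)
    (U : 'M[R]_(m, k)) (s : 'rV[R]_k) :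
    orthonormal_cols U -> (forall i, s 0 i != 0) ->
  (diag_mx (\row_i (s 0 i)^-1) *m U^T) *m (U *m diag_mx s) = 1%:M.
Proof.
move=> /orthonormal_colsP UtU s_neq0.
rewrite mulmxA -(mulmxA _ _ U) UtU mulmx1 mulmx_diag -diag_const_mx.
by congr diag_mx; apply/rowP => i; rewrite !mxE mulVf.
Qed.

Lemma weight_mul_sqr_norm2 (R : rcfType) (n k c : nat) (V : 'M[R]_(n, k))
    (t : 'I_c -> 'I_n) (w : 'I_c -> R) (j : 'I_c) :
    0 <= w j -> orthonormal_cols (V^T *m sampling_matrix t w) ->
  w j * norm2 (V^T *m std_basis R (t j)) ^+ 2 = 1.
Proof.
move=> wj_ge0 /(_ j j); rewrite eqxx mulr1n => <-.
rewrite sqr_norm2 mulr_sumr; apply: eq_bigr => l _.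
have /colP/(_ l) := col_mul_sampling V^T t w j.
by rewrite mxE [RHS]mxE => ->; rewrite -expr2 exprMn sqr_sqrtr.
Qed.

Theorem theorem2p6 (R : rcfType) (m n k : nat) (A : 'M[R]_(m, n))
    (hk : k = \rank A)
    (U : 'M[R]_(m, k)) (s : 'rV[R]_k) (V : 'M[R]_(n, k))
    (hsvd : thin_svd A U s V)
    (t : 'I_k -> 'I_n) (w : 'I_k -> R) (hw : forall j : 'I_k, 0 <= w j) :
  (\sum_(j < k) w j *: (col (t j) A *m (col (t j) A)^T) = A *m A^T
     <-> orthonormal_rows (V^T *m sampling_matrix t w))
  /\
  (orthonormal_rows (V^T *m sampling_matrix t w) ->
     orthogonal_matrix (V^T *m sampling_matrix t w)
     /\ forall j : 'I_k,
          norm2 (V^T *m std_basis R (t j)) != 0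
          /\ w j = 1 / norm2 (V^T *m std_basis R (t j)) ^+ 2).
Proof.
have [_ oU /orthonormal_colsP VtV [s_gt0 _] defA] := hsvd.
set M := V^T *m sampling_matrix t w.
split=> [|/orthonormal_rowsP MMt].
  pose B := U *m diag_mx s.
  have sumE : \sum_(j < k) w j *: (col (t j) A *m (col (t j) A)^T)
      = B *m (M *m M^T) *m B^T.
    have -> : B *m (M *m M^T) *m B^T = (B *m M) *m (B *m M)^T.
      by rewrite [in RHS]trmx_mul !mulmxA.
    by rewrite sampled_outer_products // defA /B /M !mulmxA.
  have AAtE : A *m A^T = B *m 1%:M *m B^T.
    by rewrite defA -/B trmx_mul trmxK mulmxA -(mulmxA B) VtV.
  have s_neq0 i : s 0 i != 0 by rewrite gt_eqF.
  have B_inj := congr_mx_inj (svd_left_inverse oU s_neq0).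
  rewrite sumE AAtE; split=> [/B_inj/orthonormal_rowsP // |].
  by move=> /orthonormal_rowsP ->.
have MtM := mulmx1C MMt; split=> // j.
have wN : w j * norm2 (V^T *m std_basis R (t j)) ^+ 2 = 1.
  by apply: weight_mul_sqr_norm2 => //; apply/orthonormal_colsP.
have N_neq0 : norm2 (V^T *m std_basis R (t j)) != 0.
  apply/eqP => N0; move/eqP: wN.
  by rewrite N0 expr0n mulr0 eq_sym oner_eq0.
by split=> //; rewrite -wN mulfK // expf_neq0.
Qed.
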